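(* (1) If $H$ is a finitely generated subgroup of a finitely generated group $G$ and $g_H^G(r)$ is $o(r^2)$, then $H$ is virtually cyclic. (2) Let $H$ be a finitely generated subgroup of a finitely generated group $G$. If $g_H^G(r)$ is $o^e(r^2)$, then $\Delta_H^G(r)$ is bounded above by a recursive function. (3) One may not replace $o^e(r^2)$ by $o(r^2)$ in (2): there exist a finitely generated group $G$ and a finitely generated subgroup $H\le G$ such that $g_H^G(r)$ is $o(r^2)$ but $\Delta_H^G(r)$ is not bounded above by any recursive function.
   Context: $\mathbb{N}=\{1,2,\dots\}$. For a group $G$ with finite generating set $X$, $|g|_X$ denotes word length. For a subgroup $H$ of $G$, with $H$ and $G$ generated by finite sets $Y$ and $X$ respectively, the relative growth function of $H$ in $G$ is $g_H^G(r)=\#\{h\in H:|h|_X\le r\}$, and the distortion function is $\Delta_H^G(r)=\max\{|h|_Y: h\in H,\ |h|_X\le r\}$, $r\in\mathbb{N}$. (The properties in the statement do not depend on the choice of finite generating sets.) $f(r)$ is $o(g(r))$ if $\lim_{r\to\infty} f(r)/g(r)=0$. The effective limit of a function $f$ on $\mathbb{N}$ equals $M\in\mathbb{R}$ if there is an algorithm that, given an integer $n>0$, computes $N=N(n)$ such that $|f(r)-M|<\frac1n$ for every $r>N$. One writes $f(r)=o^e(g(r))$ (and says $f$ is $o^e(g)$) if the effective limit of $f(r)/g(r)$ is $0$. *)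

(* Defs.v *)
From HB Require Import structures.
From mathcomp Require Import all_boot all_order all_algebra finmap.
From mathcomp Require Import all_classical all_reals all_analysis.

Set Implicit Arguments.
Unset Strict Implicit.
Unset Printing Implicit Defensive.

Import Order.TTheory GRing.Theory Num.Theory.
Import numFieldNormedType.Exports.

Local Open Scope classical_set_scope.

Section Groups.
Variable G : groupType.
Local Open Scope group_scope.
Implicit Types (X Y H K A : set G) (g : G) (w : seq G) (n r : nat).

Definition is_subgroup H : Prop := group_closed (mem H).

Definition generated X : set G := smallest is_subgroup X.

Definition finite_generating_set X H : Prop :=
  finite_set X /\ generated X = H.

Definition word_over X w : Prop :=
  forall x, x \in w -> X x \/ X x^-1.

Definition represented_in_length X g n : Prop :=
  exists w, [/\ word_over X w, size w = n & \prod_(x <- w) x = g].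

(* |g|_X; the junk value 0 is only taken when g is not in [generated X]. *)
Definition word_length X g : nat :=
  if pselect (exists n, `[< represented_in_length X g n >]) is left ex
  then ex_minn ex else 0%N.

(* When X is finite and generates a group containing H, this set is finite,
   so that [fset_set] below faithfully enumerates it. *)
Definition relative_ball X H r : set G :=
  [set h | H h /\ (word_length X h <= r)%N].

Definition relative_growth X H r : nat :=
  #|` fset_set (relative_ball X H r)|%fset.

Definition distortion X Y H r : nat :=
  (\max_(h <- fset_set (relative_ball X H r)) word_length Y h)%N.

Definition left_coset g K : set G := [set g * k | k in K].

Definition finite_index K H : Prop := finite_set [set left_coset h K | h in H].

Definition virtually_cyclic H : Prop :=
  exists2 a, H a & finite_index (generated [set a]) H.

End Groups.

(* Kleene's mu-recursive functions: codes of n-ary partial functions. *)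
Inductive mu_code : nat -> Type :=
| Mu_zero n : mu_code n
| Mu_succ : mu_code 1
| Mu_proj n : 'I_n -> mu_code n
| Mu_comp m n : mu_code m -> ('I_m -> mu_code n) -> mu_code n
| Mu_rec n : mu_code n -> mu_code n.+2 -> mu_code n.+1
| Mu_min n : mu_code n.+1 -> mu_code n.

(* [mu_eval c v y]: the partial function coded by c is defined at v with
   value y. In [Mu_rec f g] the recursion is on the first argument, and g
   receives the predecessor, the previous value, and the parameters. *)
Fixpoint mu_eval n (c : mu_code n) : n.-tuple nat -> nat -> Prop :=
  match c in mu_code n return n.-tuple nat -> nat -> Prop with
  | Mu_zero _ => fun _ y => y = 0%N
  | Mu_succ => fun v y => y = (thead v).+1
  | Mu_proj _ i => fun v y => y = tnth v i
  | Mu_comp m _ f g => fun v y =>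
      exists w : m.-tuple nat,
        (forall i, mu_eval (g i) v (tnth w i)) /\ mu_eval f w y
  | Mu_rec n f g => fun v y =>
      let params : n.-tuple nat := [tuple of behead v] in
      (fix iterate (k : nat) (z : nat) : Prop :=
         match k with
         | 0%N => mu_eval f params z
         | k'.+1 => exists2 z', iterate k' z' &
                      mu_eval g [tuple of k' :: z' :: params] z
         end) (thead v) y
  | Mu_min _ f => fun v y =>
      mu_eval f [tuple of y :: v] 0%N /\
      forall z, (z < y)%N -> exists k, mu_eval f [tuple of z :: v] k.+1
  end.

Definition recursive (f : nat -> nat) : Prop :=
  exists c : mu_code 1, forall n, mu_eval c [tuple n] (f n).

(* Sequences are indexed by {1, 2, ...}: values at 0 are irrelevant. *)
Definition bounded_by_recursive (D : nat -> nat) : Prop :=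
  exists2 f, recursive f & forall r, (0 < r)%N -> (D r <= f r)%N.

Section Asymptotics.
Variable R : realType.
Local Open Scope ring_scope.

Definition is_o (f g : nat -> R) : Prop :=
  (f r / g r) @[r --> \oo] --> (0 : R).

Definition effective_limit (f : nat -> R) (M : R) : Prop :=
  exists2 N : nat -> nat, recursive N &
    forall n, (0 < n)%N -> forall r, (N n < r)%N -> `|f r - M| < n%:R^-1.

Definition is_oe (f g : nat -> R) : Prop :=
  effective_limit (fun r => f r / g r) 0.

End Asymptotics.

(* Main.v *)
(* (1) Factors of shortlex-reduced words are reduced. If the growth is o(r^2)
   then, for some n, at most n/2 reduced words have length n; a Morse-Hedlund
   argument then shows that every reduced word is u x^k y with u, x, y of
   bounded length, so H is a finite union of cosets of cyclic subgroups, and one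
   of these has finite index by B. H. Neumann's lemma.

   (2) By (1), H is a finite union of cosets of some <a>. If a has infinite order
   and a^n has length rho, then up to a radius R of order n the elements
   a^(i n + j) make up at least c R^2 / rho elements of the ball of radius R, so
   the modulus of convergence bounds n in terms of rho.

   (3) Let t translate the lines of Z x Z, let f reflect the line R_k by
   x |-> N_k - x for every k, and let g and a act on the line 0 only, by -x and
   x + 1. Then a^(2 N_k) = (t^-R_k f t^R_k g)^2 has length at most 4 R_k + 4,
   and N_k may outgrow every recursive function of R_k. Conversely two uses
   of the reflection of the line R_k cancel unless a lower line is visited in
   between, so for R_k <= r < R_(k+1) the length of a^n is at most r only if
   n = M + l N_k with |M| <= r N_(k-1) and |l| <= r / (2 (R_k - R_(k-1))). There
   are o(r^2) such n when R_k - R_(k-1) = k N_(k-1). *)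
Require Import Defs.
From HB Require Import structures.
From mathcomp Require Import all_boot all_order all_algebra finmap.
From mathcomp Require Import all_classical all_reals all_analysis.
From mathcomp Require Import zify.

Set Implicit Arguments.
Unset Strict Implicit.
Unset Printing Implicit Defensive.

Import Order.TTheory GRing.Theory Num.Theory.
Import numFieldNormedType.Exports.

Local Open Scope classical_set_scope.

(** * Word length and relative balls *)

Section Words.
Variable G : groupType.
Local Open Scope group_scope.
Implicit Types (X Y H K A : set G) (g h x : G) (w : seq G) (n r : nat).

Lemma subgroup1 H : is_subgroup H -> H 1.
Proof. by case=> /[!inE]. Qed.

Lemma subgroupV H x : is_subgroup H -> H x -> H x^-1.
Proof.
move=> Hsub; have /(_ x) := group_closedV Hsub.
by rewrite !inE.
Qed.

Lemma subgroupM H x y : is_subgroup H -> H x -> H y -> H (x * y).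
Proof.
move=> Hsub; have /(_ x y) := group_closedM Hsub.
by rewrite !inE.
Qed.

Lemma subgroupX H x n : is_subgroup H -> H x -> H (x ^+ n).
Proof.
move=> Hsub Hx; elim: n => [|n IH]; first exact: subgroup1.
by rewrite expgS; apply: subgroupM.
Qed.

Lemma is_subgroupI H : H 1 -> (forall x y, H x -> H y -> H (x * y^-1)) ->
  is_subgroup H.
Proof. by move=> H1 HD; split=> [|x y] /[!inE]//; apply: HD. Qed.

Lemma subgroup_prod H w : is_subgroup H -> (forall x, x \in w -> H x) ->
  H (\prod_(x <- w) x).
Proof.
move=> Hsub; elim: w => [_|x w IH Hw]; first by rewrite big_nil; apply: subgroup1.
rewrite big_cons; apply: subgroupM => //; first exact/Hw/mem_head.
by apply: IH => y yw; apply: Hw; rewrite inE yw orbT.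
Qed.

Lemma word_over_nil X : word_over X [::]. Proof. by []. Qed.

Lemma word_over_cat X w w' :
  word_over X w -> word_over X w' -> word_over X (w ++ w').
Proof. by move=> Xw Xw' x; rewrite mem_cat => /orP[/Xw|/Xw']. Qed.

Lemma word_over_inv X w :
  word_over X w -> word_over X (rev [seq x^-1 | x <- w]).
Proof.
move=> Xw x; rewrite mem_rev => /mapP[y /Xw + ->].
by rewrite invgK => -[]; [right|left].
Qed.

Lemma prod_inv w : \prod_(x <- rev [seq x^-1 | x <- w]) x = (\prod_(x <- w) x)^-1.
Proof.
elim: w => [|x w IH]; first by rewrite /rev !big_nil invg1.
by rewrite /= rev_cons -cats1 big_cat /= big_seq1 IH big_cons invgM.
Qed.

Lemma generatedP X g :
  generated X g <-> exists2 w, word_over X w & \prod_(x <- w) x = g.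
Proof.
split=> [|[w Xw <-] K [Ksub XK]]; last first.
  apply: subgroup_prod => // x /Xw[/XK //|/XK].
  by move=> /(subgroupV Ksub); rewrite invgK.
move/(_ [set h | exists2 w, word_over X w & \prod_(x <- w) x = h]).
apply; split=> [|x Xx]; last first.
  by exists [:: x]; rewrite ?big_seq1// => y /[!inE]/eqP ->; left.
apply: is_subgroupI => [|_ _ [u Xu <-] [v Xv <-]].
  by exists [::]; rewrite ?big_nil.
exists (u ++ rev [seq x^-1 | x <- v]); last by rewrite big_cat prod_inv.
by apply: word_over_cat => //; apply: word_over_inv.
Qed.

Lemma generated_is_subgroup X : is_subgroup (generated X).
Proof.
apply: is_subgroupI => [|g h Xg Xh] K [Ksub XK]; first exact: subgroup1.
by apply: subgroupM => //; [exact: Xg | apply: subgroupV => //; exact: Xh].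
Qed.

Lemma sub_generated X : X `<=` generated X.
Proof. by move=> x Xx K [_]; apply. Qed.

Lemma word_length_le X w :
  word_over X w -> (word_length X (\prod_(x <- w) x)%g <= size w)%N.
Proof.
move=> Xw; rewrite /word_length; case: pselect => // ex; case: ex_minnP => m _.
by apply; apply/asboolP; exists w.
Qed.

Lemma word_lengthP X g : generated X g ->
  exists w, [/\ word_over X w, size w = word_length X g & \prod_(x <- w) x = g].
Proof.
move=> /generatedP[w Xw wg]; rewrite /word_length; case: pselect; last first.
  by case; exists (size w); apply/asboolP; exists w.
by move=> ex; case: ex_minnP => m /asboolP.
Qed.

Lemma word_lengthM X g h : generated X g -> generated X h ->
  (word_length X (g * h)%g <= word_length X g + word_length X h)%N.
Proof.
move=> /word_lengthP[u [Xu <- ug]] /word_lengthP[v [Xv <- vh]].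
by rewrite -size_cat -ug -vh -big_cat word_length_le//; apply: word_over_cat.
Qed.

Lemma word_lengthV X g : generated X g ->
  (word_length X (g^-1)%g <= word_length X g)%N.
Proof.
move=> /word_lengthP[u [Xu <- ug]].
rewrite -ug -prod_inv (_ : size u = size (rev [seq x^-1 | x <- u])).
  exact/word_length_le/word_over_inv.
by rewrite size_rev size_map.
Qed.

Lemma word_length1 X : word_length X (1 : G) = 0%N.
Proof.
have := @word_length_le X [::] (@word_over_nil X).
by rewrite big_nil leqn0 => /eqP.
Qed.

Lemma word_lengthX X g n : generated X g ->
  (word_length X (g ^+ n)%g <= n * word_length X g)%N.
Proof.
move=> Xg; elim: n => [|n IH]; first by rewrite expg0 word_length1.
rewrite expgS mulSn (leq_trans (word_lengthM _ _))// ?leq_add2l//.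
exact: subgroupX (generated_is_subgroup X) Xg.
Qed.

Lemma symmetrized_seq X : finite_set X ->
  exists s : seq G, forall x, x \in s <-> X x \/ X x^-1.
Proof.
move=> /finite_seqP[s ->]; exists (s ++ [seq x^-1 | x <- s]) => x.
rewrite mem_cat; split=> [/orP[|/mapP[y ys ->]]|[->//|xs]].
- by left.
- by right; rewrite /= invgK.
- by apply/orP; right; apply/mapP; exists x^-1 => //; rewrite invgK.
Qed.

End Words.

Section Cardinal.
Variable T : choiceType.
Implicit Types (A : set T) (l : seq T).

Lemma leq_size_fset_set A l : finite_set A -> uniq l ->
  (forall x, x \in l -> A x) -> (size l <= #|` fset_set A|)%N.
Proof.
move=> finA ul lA; apply: uniq_leq_size => // x /lA Ax.
by rewrite in_fset_set// inE.
Qed.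

End Cardinal.

Lemma fset_set_leq_size (T : choiceType) (U : eqType) (f : T -> U) (A : set T)
    (l : seq U) : finite_set A -> {in A &, injective f} ->
  (forall x, A x -> f x \in l) -> (#|` fset_set A| <= size l)%N.
Proof.
move=> finA fI Al; have mA x : x \in (fset_set A : seq T) -> A x.
  by rewrite in_fset_set// inE.
rewrite -(size_map f); apply: uniq_leq_size => [|_ /mapP[x /mA Ax ->]].
  rewrite map_inj_in_uniq ?fset_uniq// => x y /mA Ax /mA Ay.
  by apply: fI; rewrite inE.
exact: Al.
Qed.

Section Ball.
Variable G : groupType.
Local Open Scope group_scope.
Implicit Types (X Y H : set G).

(** Every count below rests on this, since [fset_set] of an infinite set is empty by default.
    Elements of length at most [r] are values of tuples of indices into a list of the generators and
    their inverses. *)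
Lemma finite_relative_ball X H r : finite_generating_set X [set: G] ->
  finite_set (relative_ball X H r).
Proof.
move=> [/symmetrized_seq[s sP] genX].
pose W := \bigcup_(n in `I_r.+1)
  ((fun t : n.-tuple 'I_(size s) => \prod_(i <- t) s`_i) @` setT).
apply: (@sub_finite_set _ _ W) => [h [_ hr]|]; last first.
  apply: bigcup_finite => [|n _]; first exact: finite_II.
  exact/finite_image/finite_finset.
have /word_lengthP[w [Xw sw wh]] : generated X h by rewrite genX.
exists (size w); first by rewrite /= sw ltnS.
have iw x : x \in w -> (index x s < size s)%N.
  by move=> /Xw/sP; rewrite index_mem.
have [t tE] : exists t : seq 'I_(size s), w = [seq s`_i | i : 'I_(size s) <- t].
  elim: w {wh sw Xw} iw => [|x w IH] iw; first by exists [::].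
  have [t ->] := IH (fun y yw => iw y (@mem_behead _ (x :: w) y yw)).
  have xs := iw x (mem_head _ _).
  by exists (Ordinal xs :: t); rewrite /= nth_index -?index_mem.
have st : size t == size w by rewrite tE size_map.
by exists (Tuple st) => //=; rewrite -wh tE big_map.
Qed.

End Ball.

(** * The asymptotic hypotheses as inequalities between natural numbers *)

Section Asymptotic.
Variable R : realType.
Local Open Scope ring_scope.

Lemma ratio_ltP (a r M : nat) : (0 < r)%N -> (0 < M)%N ->
  `|a%:R / r%:R ^+ 2 - 0 : R| < M%:R^-1 <-> (M * a < r ^ 2)%N.
Proof.
move=> r0 M0; have rP : 0 < r%:R ^+ 2 :> R by rewrite exprn_gt0// ltr0n.
have MP : 0 < M%:R :> R by rewrite ltr0n.
rewrite subr0 ger0_norm ?divr_ge0 ?ler0n ?ltW//.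
rewrite ltr_pdivrMr// mulrC ltr_pdivlMr// -natrX -natrM ltr_nat mulnC.
by [].
Qed.

Lemma is_o_sqP (f : nat -> nat) :
  is_o (fun r => (f r)%:R : R) (fun r => r%:R ^+ 2) <->
  forall M, (0 < M)%N ->
    exists r0, forall r, (r0 < r)%N -> (M * f r < r ^ 2)%N.
Proof.
split=> [/cvgrPdist_lt fo M M0|fo].
  have /fo[r0 _ r0P] : 0 < M%:R^-1 :> R by rewrite invr_gt0 ltr0n.
  exists r0 => r rr0; apply/(@ratio_ltP _ _ _ _ M0).
    exact: leq_ltn_trans rr0.
  by rewrite distrC; apply: r0P; rewrite /= ltnW.
apply/cvgrPdist_lt => e e0; near \oo => M.
have M0 : (0 < M)%N by near: M; exact: nbhs_infty_gt.
have Me : M%:R^-1 < e :> R.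
  rewrite invf_plt ?posrE ?ltr0n//.
  near: M; exact: nbhs_infty_gtr.
have [r0 r0P] := fo M M0.
exists r0.+1 => // r /= rr0; rewrite distrC (lt_trans _ Me)//.
by apply/ratio_ltP => //; [exact: leq_ltn_trans rr0 | exact: r0P].
Unshelve. all: by end_near. Qed.

Lemma is_oe_sq (f : nat -> nat) :
  is_oe (fun r => (f r)%:R : R) (fun r => r%:R ^+ 2) ->
  exists2 N, recursive N &
    forall M r, (0 < M)%N -> (N M < r)%N -> (M * f r < r ^ 2)%N.
Proof.
move=> [N recN NP]; exists N => // M r M0 rN.
by apply/(@ratio_ltP _ _ _ _ M0); [exact: leq_ltn_trans rN | exact: NP].
Qed.

End Asymptotic.

(** * Words with few factors *)

Section FactorialLanguage.
Variables (T : eqType) (L : seq T -> Prop).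
Hypothesis L_factor : forall p u q, L (p ++ u ++ q) -> L u.

(** [e] is the excluded end of a run of period [p] starting at [i]; the [k] blocks that fit into the
    run all repeat the first one. *)
Lemma drop_periodic (x0 : T) w i p e k :
  (e <= size w)%N ->
  (forall x, (i <= x)%N -> (x + p < e)%N -> nth x0 w x = nth x0 w (x + p)) ->
  (i + k * p <= e)%N ->
  drop i w = flatten (nseq k (take p (drop i w))) ++ drop (i + k * p) w.
Proof.
move=> ew per; elim: k => [|k IH] ke; first by rewrite mul0n addn0.
have ke' : (i + k * p + p <= e)%N by lia.
rewrite {1}IH; last by lia.
rewrite -addn1 nseqD flatten_cat /= cats0 -catA; congr (_ ++ _).
rewrite -{1}(cat_take_drop p (drop (i + k * p) w)) drop_drop.
congr (_ ++ drop _ _); last by lia.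
have sz : size (take p (drop (i + k * p) w)) = p.
  by rewrite size_takel// size_drop; lia.
have sz' : size (take p (drop i w)) = p by rewrite size_takel// size_drop; lia.
apply: (@eq_from_nth _ x0); rewrite ?sz ?sz'// => y yp.
rewrite !nth_take// !nth_drop {IH sz sz'}.
elim: k ke ke' => [|k IH] ke ke'; first by rewrite mul0n addn0.
rewrite -IH; try lia.
by rewrite [RHS]per; [congr (nth _ _ _); lia | lia | lia].
Qed.

(* Two coinciding windows among the first ones give a run of period p <= n/2.
   If this run stopped more than n letters before the end of w, the n - p
   windows straddling its end would be pairwise distinct and distinct from the
   windows inside the run, giving more than n/2 factors of length n. *)
Lemma few_factors_periodic (n : nat) (S : seq (seq T)) w :
  (forall u, L u -> size u = n -> u \in S) -> (2 * size S <= n)%N -> L w ->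
  exists u x y k, [/\ w = u ++ flatten (nseq k x) ++ y,
    (size u <= n)%N, (size x <= n)%N & (size y <= 2 * n)%N].
Proof.
move=> SP Sn Lw; have [wn|nw] := leqP (size w) (2 * n).
  by exists [::], [::], w, 0%N.
have [x0 _] : exists x0 : T, True by case: (w) nw => // x; exists x.
pose W i := take n (drop i w).
have sW i : (i + n <= size w)%N -> size (W i) = n.
  by move=> iw; rewrite size_takel// size_drop; lia.
have nW i y : (y < n)%N -> nth x0 (W i) y = nth x0 w (i + y).
  by move=> yn; rewrite nth_take// nth_drop.
have WS i : (i + n <= size w)%N -> W i \in S.
  move=> iw; apply: SP; last exact: sW.
  apply: (L_factor (p := take i w) (q := drop n (drop i w))).
  by rewrite /W !cat_take_drop.
(* Pigeonhole: the windows starting at [0, ..., size S] all lie in [S]. *)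
have [i [j [ij jm Wij]]] : exists i j, [/\ (i < j)%N, (j <= size S)%N & W i = W j].
  have : ~~ uniq [seq W i | i <- iota 0 (size S).+1].
    apply/negP => uW; have : (size [seq W i | i <- iota 0 (size S).+1] <= size S)%N.
      apply: uniq_leq_size => // _ /mapP[i + ->].
      by rewrite mem_iota => /andP[_ iS]; apply: WS; lia.
    by rewrite size_map size_iota; lia.
  move=> /(uniqPn [::])[i [j []]]; rewrite size_map size_iota => ij jS.
  rewrite !(nth_map 0%N) ?size_iota ?nth_iota//; try lia.
  by rewrite !add0n; exists i, j; split.
pose p := (j - i)%N.
pose P e := forall x, (i <= x)%N -> (x + p < e)%N -> nth x0 w x = nth x0 w (x + p).
have Pj : P (j + n)%N.
  move=> x ix xe.
  have := congr1 (fun s => nth x0 s (x - i)) Wij => /=.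
  rewrite !nW; try (rewrite /p in xe; lia).
  by rewrite subnKC// => ->; congr (nth _ _ _); rewrite /p; lia.
have exP : exists e, `[< P e >] && (e <= size w)%N.
  by exists (j + n)%N; rewrite asboolT//=; lia.
have ubP e : `[< P e >] && (e <= size w)%N -> (e <= size w)%N by case/andP.
(* [e] is the end of the longest run of period [p] starting at [i]. *)
case: (ex_maxnP exP ubP) => e /andP[/asboolP Pe ew] emax.
have je : (j + n <= e)%N by apply: emax; rewrite asboolT//=; lia.
have [we|ew'] := leqP (size w) (e + n).
  (* Whole periods are cut off while they fit into the run; fewer than [n + p] letters remain. *)
  pose k := ((e - i) %/ p)%N.
  have kp : (i + k * p <= e)%N by have := leq_divM (e - i) p; rewrite /k; lia.
  have kp' : (e < i + k * p + p)%N.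
    have : (e - i < k.+1 * p)%N by rewrite /k ltn_ceil// /p; lia.
    by rewrite mulSn; lia.
  exists (take i w), (take p (drop i w)), (drop (i + k * p) w), k; split.
  - by rewrite -(drop_periodic ew Pe kp) cat_take_drop.
  - by rewrite size_takel; lia.
  - by rewrite size_takel// ?size_drop /p; lia.
  - by rewrite size_drop /p in kp' *; lia.
exfalso.
(* Otherwise the run could be extended by the letter at [e]. *)
have brk : nth x0 w (e - p) <> nth x0 w e.
  move=> be; have : (e.+1 <= e)%N; last by lia.
  apply: emax; apply/andP; split; last by lia.
  apply/asboolP => x ix; rewrite ltnS leq_eqVlt => /orP[/eqP xe|]; last exact: Pe.
  by rewrite xe -be; congr (nth _ _ _); rewrite -xe; lia.
(* The windows of the list contain both letters [e - p] and [e], which differ. At the offsets where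
   one of them shows this break, any earlier one, and also [W i], shows two equal letters of the
   run. *)
have uW : uniq (W i :: [seq W t | t <- iota (e - n).+1 (n - p)]).
  rewrite cons_uniq; apply/andP; split.
    apply/negP => /mapP[t]; rewrite mem_iota => /andP[et te] WW.
    have := congr1 (fun s => nth x0 s (e - t)) WW.
    have := congr1 (fun s => nth x0 s (e - t - p)) WW => /=.
    rewrite !nW; try lia.
    have -> : (t + (e - t - p) = e - p)%N by rewrite /p in te *; lia.
    have -> : (t + (e - t) = e)%N by lia.
    move=> eqp eq; apply: brk; rewrite -eqp -eq Pj; [|lia|rewrite /p in te *; lia].
    by congr (nth _ _ _); rewrite /p in te *; lia.
  rewrite map_inj_in_uniq ?iota_uniq//.
  have main s t : s \in iota (e - n).+1 (n - p) -> t \in iota (e - n).+1 (n - p) ->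
      (t < s)%N -> W t <> W s.
    rewrite !mem_iota => /andP[es se] /andP[et te] ts WW.
    have := congr1 (fun z => nth x0 z (e - s)) WW.
    have := congr1 (fun z => nth x0 z (e - s - p)) WW => /=.
    rewrite !nW; try lia.
    have -> : (s + (e - s - p) = e - p)%N by rewrite /p in se *; lia.
    have -> : (s + (e - s) = e)%N by lia.
    move=> eqp eq; apply: brk; rewrite -eqp -eq Pe.
    - by congr (nth _ _ _); rewrite /p in se *; lia.
    - rewrite /p in se *; lia.
    - rewrite /p in se *; lia.
  move=> s t sI tI WW; apply/eqP; rewrite eqn_leq.
  apply/andP; split; rewrite leqNgt; apply/negP => lt.
  - exact: (main s t sI tI lt (esym WW)).
  - exact: (main t s tI sI lt WW).
have /(uniq_leq_size uW) :
    {subset W i :: [seq W t | t <- iota (e - n).+1 (n - p)] <= S}.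
  move=> v; rewrite inE => /orP[/eqP ->|/mapP[t]]; first by apply: WS; lia.
  rewrite mem_iota => /andP[et te] ->; apply: WS; rewrite /p in te; lia.
by rewrite /= size_map size_iota /p; lia.
Qed.

End FactorialLanguage.

(** * Reduced words and coverings by cosets *)

Section ReducedWords.
Variables (G : groupType) (s : seq G).
Local Open Scope group_scope.
Implicit Types u v w : seq 'I_(size s).

Definition eval_word w : G := \prod_(i <- w) s`_i.

(* Numerals in base [(size s).+1] without the digit 0: comparing codes is the
   shortlex order on (reversed) words. *)
Fixpoint word_code w : nat :=
  if w is i :: w' then (i.+1 + (size s).+1 * word_code w')%N else 0%N.

Definition reduced_word w : Prop :=
  forall w', eval_word w' = eval_word w -> (word_code w <= word_code w')%N.

Lemma eval_word_cat u v : eval_word (u ++ v) = eval_word u * eval_word v.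
Proof. by rewrite /eval_word big_cat. Qed.

Lemma word_code_cat u v :
  word_code (u ++ v) = (word_code u + (size s).+1 ^ size u * word_code v)%N.
Proof.
elim: u => [|i u IH] /=; first by rewrite mul1n.
by rewrite IH expnS; lia.
Qed.

Lemma word_code_inj : injective word_code.
Proof.
elim=> [|i u IH] [|j v] //= eq_code.
have [eij euv] : (i = j :> nat) /\ word_code u = word_code v.
  have := ltn_ord i; have := ltn_ord j => jd id.
  have : (i.+1 + (size s).+1 * word_code u = j.+1 + (size s).+1 * word_code v
          %[mod (size s).+1])%N by rewrite eq_code.
  rewrite !(addnC _.+1) !(mulnC (size s).+1) !modnMDl !modn_small; try lia.
  move=> [eij]; split => //; move: eq_code; rewrite eij => /addnI/eqP.
  by rewrite eqn_mul2l /= => /eqP.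
by rewrite (IH _ euv) (val_inj eij).
Qed.

Lemma word_code_ltn u v : (size u < size v)%N -> (word_code u < word_code v)%N.
Proof.
elim: u v => [|i u IH] [|j v] //= /IH uv.
have : ((size s).+1 * (word_code u).+1 <= (size s).+1 * word_code v)%N.
  by rewrite leq_mul2l uv.
by rewrite mulnS; have := ltn_ord i; lia.
Qed.

(** A smaller word [u'] with the value of [u] would yield a smaller word for the whole product: [u']
    is not longer than [u], so the weight given to the code of [q] does not grow. *)
Lemma reduced_word_factor p u q : reduced_word (p ++ u ++ q) -> reduced_word u.
Proof.
move=> red u' u'u; rewrite leqNgt; apply/negP => lt.
have /red : eval_word (p ++ u' ++ q) = eval_word (p ++ u ++ q).
  by rewrite !eval_word_cat u'u.
rewrite !word_code_cat leq_add2l leq_pmul2l ?expn_gt0//.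
have : (size u' <= size u)%N.
  by rewrite leqNgt; apply/negP => /word_code_ltn; lia.
rewrite -(leq_exp2l (m := (size s).+1)); last first.
  move: lt; case: (u) => [|i ? _]; rewrite ?ltn0 ?ltnS//.
  exact: leq_ltn_trans (ltn_ord i).
move=> /(leq_mul (leqnn (word_code q))); lia.
Qed.

Lemma reduced_word_exists w : exists2 v, reduced_word v & eval_word v = eval_word w.
Proof.
have ex : exists n, `[< exists2 v, word_code v = n & eval_word v = eval_word w >].
  by exists (word_code w); apply/asboolP; exists w.
case: (ex_minnP ex) => n /asboolP[v <- vw] vmin; exists v => // v' v'v.
by apply: vmin; apply/asboolP; exists v' => //; rewrite v'v.
Qed.

Lemma reduced_word_inj u v : reduced_word u -> reduced_word v ->
  eval_word u = eval_word v -> u = v.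
Proof.
move=> ru rv uv; apply: word_code_inj; apply/eqP.
by rewrite eqn_leq ru ?rv.
Qed.

Definition reduced_words n : seq (seq 'I_(size s)) :=
  [seq w <- [seq tval t | t : n.-tuple 'I_(size s)] | `[< reduced_word w >]].

Lemma mem_reduced_words n w :
  w \in reduced_words n <-> reduced_word w /\ size w = n.
Proof.
rewrite mem_filter; split=> [/andP[/asboolP + /mapP[t _ wt]]|[rw /eqP wn]].
  by rewrite wt size_tuple; split.
apply/andP; split; first exact/asboolP.
by apply/mapP; exists (Tuple wn) => //; rewrite mem_enum.
Qed.

Lemma uniq_reduced_words n : uniq (reduced_words n).
Proof. by rewrite filter_uniq// map_inj_uniq ?enum_uniq//; exact: val_inj. Qed.

(** Distinct reduced words have distinct values, and more than [n / 2] of them for each length [n]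
    up to [N] add up to at least [N ^ 2 / 4]. *)
Lemma many_reduced_words N :
  (forall n, (0 < n <= N)%N -> (n < 2 * size (reduced_words n))%N) ->
  exists l : seq G, [/\ uniq l, (N ^ 2 <= 4 * size l)%N &
    forall g, g \in l -> exists2 w, (size w <= N)%N & eval_word w = g].
Proof.
move=> many; suff [l [ul Nl lP]] : exists l, [/\ uniq l, (N ^ 2 <= 4 * size l)%N &
    forall w, w \in l -> reduced_word w /\ (size w <= N)%N].
  exists [seq eval_word w | w <- l]; split; last 1 first.
  - by move=> _ /mapP[w wl ->]; exists w => //; have [] := lP w wl.
  - rewrite map_inj_in_uniq// => u v /lP[ru _] /lP[rv _].
    exact: reduced_word_inj.
  - by rewrite size_map.
elim: N many => [|N IH] many; first by exists [::].
have [|l [ul Nl lP]] := IH; first by move=> n nN; apply: many; lia.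
exists (l ++ reduced_words N.+1); split.
- rewrite cat_uniq ul uniq_reduced_words andbT; apply/hasPn => w.
  move=> /mem_reduced_words[_ wN]; apply/negP => /lP[_]; rewrite wN; lia.
- have := many N.+1 (leqnn _); rewrite size_cat; move: Nl; rewrite -!mulnn.
  by move: (size l) (size (reduced_words _)) => a b; lia.
- move=> w; rewrite mem_cat => /orP[/lP[rw]|/mem_reduced_words[rw]]; split=> //; lia.
Qed.

End ReducedWords.

(** * Coverings of a group by finitely many cosets *)

Section Neumann.
Variable G : groupType.
Local Open Scope group_scope.
Implicit Types (H K : set G) (g h : G).

Definition finitely_many_cosets K H :=
  exists l : seq G, forall h, H h -> exists2 g, g \in l & K (g^-1 * h).

Lemma finite_indexP K H : is_subgroup K -> 
  finitely_many_cosets K H -> finite_index K H.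
Proof.
move=> Ksub [l lP]; apply: (@sub_finite_set _ _ [set left_coset g K | g in [set` l]]).
  move=> _ [h /lP[g gl Kgh] <-]; exists g => //.
  apply/seteqP; split=> _ [k Kk <-].
    exists ((g^-1 * h)^-1 * k); first by apply: subgroupM => //; exact: subgroupV.
    by rewrite invgM invgK !mulgA mulgV mul1g.
  exists (g^-1 * h * k); first exact: subgroupM.
  by rewrite !mulgA mulgV mul1g.
exact/finite_image/finite_seq.
Qed.

(* B. H. Neumann: if some coset of K is missing from the covering, it is covered
   by cosets of the other subgroups, hence so is every coset of K. *)
Lemma neumann_cover H (Ks : seq (set G)) (l : seq (G * set G)) :
  is_subgroup H ->
  (forall K, K \in Ks -> is_subgroup K /\ K `<=` H) ->
  (forall gK, gK \in l -> H gK.1 /\ gK.2 \in Ks) ->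
  (forall h, H h -> exists2 gK, gK \in l & gK.2 (gK.1^-1 * h)) ->
  exists2 K, K \in Ks & finitely_many_cosets K H.
Proof.
move=> Hsub; elim: Ks l => [|K Ks IH] l KsP lKs lH.
  have [gK gKl _] := lH 1 (subgroup1 Hsub).
  by have [] := lKs gK gKl.
have [Ksub KH] := KsP K (mem_head _ _).
have [Kcov|] := pselect (forall h, H h -> exists2 gK, gK \in l &
    gK.2 = K /\ K (gK.1^-1 * h)).
  exists K; first exact: mem_head.
  exists [seq gK.1 | gK <- l] => h /Kcov[gK gKl [_ KgK]].
  by exists gK.1 => //; apply: map_f.
move=> /existsNP[h0 /not_implyP[Hh0 noK]].
(* As [h0] lies in no listed coset of [K], the coset [h0 K] is covered by listed cosets of the other
   subgroups. Their translates by [g h0^-1] cover [g K]. *)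
have [|||K' K'Ks finK'] := IH
  ([seq gK <- l | gK.2 \in Ks] ++
   flatten [seq [seq (gK.1 * h0^-1 * hK.1, hK.2) | hK <- l & hK.2 \in Ks] | gK <- l]).
- by move=> K' K'Ks; apply: KsP; rewrite inE K'Ks orbT.
- move=> gK; rewrite mem_cat mem_filter => /orP[/andP[gKs gl]|].
    by have [] := lKs gK gl.
  move=> /flattenP[_ /mapP[hK hl ->] /mapP[h'K]].
  rewrite mem_filter => /andP[h'Ks h'l] -> /=; split => //.
  have [Hh _] := lKs _ hl; have [Hh' _] := lKs _ h'l.
  by apply: subgroupM => //; apply: subgroupM => //; exact: subgroupV.
- move=> h Hh; have [[g Kg] gl /= Kgh] := lH h Hh.
  have [/= Hg] := lKs _ gl.
  have [Kg_Ks _|Kg_Ks] := boolP (Kg \in Ks).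
    by exists (g, Kg) => //; rewrite mem_cat mem_filter /= Kg_Ks gl.
  rewrite inE (negbTE Kg_Ks) orbF => /eqP KgK.
  (* [h0 g^-1 h] lies in [h0 K]; a listed coset of [K] containing it would also contain [h0]. *)
  have [|[g' K'] g'l /= K'gh] := lH (h0 * (g^-1 * h)).
    by apply: subgroupM => //; apply: subgroupM => //; exact: subgroupV.
  have K'Ks : K' \in Ks.
    have [_] := lKs _ g'l; rewrite inE => /orP[/eqP /= K'K|//].
    case: noK; exists (g', K') => //=; split=> //.
    rewrite -(mulgK (g^-1 * h) (g'^-1 * h0)).
    apply: subgroupM => //; first by rewrite -K'K -mulgA.
    by apply: subgroupV => //; rewrite -KgK.
  exists (g * h0^-1 * g', K') => /=.
    rewrite mem_cat; apply/orP; right; apply/flattenP.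
    exists [seq ((g, Kg).1 * h0^-1 * hK.1, hK.2) | hK <- l & hK.2 \in Ks].
      by apply/mapP; exists (g, Kg).
    by apply/mapP; exists (g', K') => //; rewrite mem_filter K'Ks.
  by rewrite !invgM invgK -!mulgA.
by exists K' => //; rewrite inE K'Ks orbT.
Qed.

End Neumann.

(** * Subquadratic relative growth forces a virtually cyclic subgroup *)

Section VirtuallyCyclic.
Local Open Scope group_scope.

Lemma bounded_words (T : finType) n :
  exists S : seq (seq T), forall w, (size w <= n)%N -> w \in S.
Proof.
exists (flatten [seq [seq tval t | t : m.-tuple T] | m <- iota 0 n.+1]) => w wn.
apply/flattenP; exists [seq tval t | t : (size w).-tuple T].
  by apply/mapP; exists (size w) => //; rewrite mem_iota.
by apply/mapP; exists (in_tuple w); rewrite ?mem_enum.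
Qed.

Lemma generated_sub (G : groupType) (A H : set G) :
  is_subgroup H -> A `<=` H -> generated A `<=` H.
Proof. by move=> Hsub AH g; apply; split. Qed.

Variables (G : groupType) (X Y H : set G).
Hypotheses (genX : finite_generating_set X [set: G]) (Hsub : is_subgroup H).
Hypothesis genY : finite_generating_set Y H.

Let XT g : generated X g. Proof. by rewrite genX.2. Qed.

Lemma word_lengths_bounded (l : seq G) :
  exists2 C, (0 < C)%N & forall g, g \in l -> (word_length X g <= C)%N.
Proof.
elim: l => [|g l [C C0 lC]]; first by exists 1%N.
exists (C + word_length X g)%N => [|h]; first by lia.
by rewrite inE => /orP[/eqP ->|/lC]; lia.
Qed.

Lemma word_length_eval_word (s : seq G) : exists2 C, (0 < C)%N &
  forall w : seq 'I_(size s), (word_length X (eval_word w) <= C * size w)%N.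
Proof.
have [C C0 sC] := word_lengths_bounded s.
exists C => //; elim=> [|i w IH]; first by rewrite /eval_word big_nil word_length1.
rewrite /eval_word big_cons (leq_trans (word_lengthM _ _))//= mulnS leq_add//.
by rewrite sC// mem_nth.
Qed.

Lemma subquadratic_virtually_cyclic :
  (forall M, (0 < M)%N -> exists r0, forall r, (r0 < r)%N ->
    (M * relative_growth X H r < r ^ 2)%N) ->
  virtually_cyclic H.
Proof.
move=> sub_quad; have [s sP] := symmetrized_seq genY.1.
have HE : H = generated Y by rewrite genY.2.
have sH g : g \in s -> H g.
  move=> /sP; rewrite HE => -[/sub_generated//|/sub_generated].
  by move=> /(subgroupV (generated_is_subgroup _)); rewrite invgK.
have evH w : H (@eval_word G s w).
  rewrite /eval_word -(big_map (fun i : 'I_(size s) => s`_i) xpredT id).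
  by apply: subgroup_prod => // _ /mapP[i _ ->]; apply/sH/mem_nth.
have Hev h : H h -> exists w, @eval_word G s w = h.
  rewrite HE => /generatedP[w Yw <-].
  elim: w Yw => [|x w IH] Yw; first by exists [::]; rewrite /eval_word !big_nil.
  have [|v vw] := IH; first by move=> y yw; apply: Yw; rewrite inE yw orbT.
  have xs : (index x s < size s)%N by rewrite index_mem; apply/sP/Yw/mem_head.
  exists (Ordinal xs :: v); rewrite /eval_word !big_cons/= nth_index -?index_mem//.
  by rewrite -vw.
(* Otherwise the ball of radius [C * r0.+1] contains at least [r0.+1 ^ 2 / 4] elements of [H],
   against the growth bound for [M = 4 * C ^ 2]. *)
have [n n0 few] : exists2 n, (0 < n)%N & (2 * size (reduced_words s n) <= n)%N.
  apply: contrapT => /forall2NP many; have [C C0 evC] := word_length_eval_word s.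
  have [|r0 r0P] := sub_quad (4 * C ^ 2)%N; first by rewrite muln_gt0 expn_gt0 C0.
  have [|l [ul Nl lP]] := @many_reduced_words G s r0.+1.
    by move=> n /andP[n0 _]; case: (many n) => // /negP; rewrite -ltnNge.
  have : (size l <= relative_growth X H (C * r0.+1))%N.
    apply: leq_size_fset_set => //; first exact: finite_relative_ball.
    move=> g /lP[w wr0 <-]; split; first exact: evH.
    by rewrite (leq_trans (evC _))// leq_mul2l wr0 orbT.
  have := r0P (C * r0.+1)%N; rewrite leq_pmull// => /(_ isT).
  rewrite expnMn -mulnA mulnCA ltn_pmul2l ?expn_gt0 ?C0//; lia.
have [S SP] := bounded_words 'I_(size s) (2 * n).
(* Since [u x^k y = (u y) (y^-1 x y)^k], the value lies in the coset of [u y] modulo the cyclic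
   group generated by the conjugate of [x] by [y]. *)
pose coset_of (p : seq 'I_(size s) * (seq 'I_(size s) * seq 'I_(size s))) :=
  (eval_word p.1 * eval_word p.2.2,
   generated [set eval_word p.2.1 ^ eval_word p.2.2]).
pose l := [seq coset_of p | p <- allpairs pair S (allpairs pair S S)].
have Kcyc K : K \in [seq gK.2 | gK <- l] -> exists2 a, H a & K = generated [set a].
  move=> /mapP[gK /mapP[[u [x y]] _ ->] ->] /=.
  exists (eval_word x ^ eval_word y) => //.
  by rewrite /conjg; apply: subgroupM => //; [exact: subgroupV | exact: subgroupM].
have [|||K /Kcyc[a Ha ->] cov] := @neumann_cover _ H [seq gK.2 | gK <- l] l Hsub.
- move=> _ /Kcyc[a Ha ->]; split; first exact: generated_is_subgroup.
  by apply: generated_sub => // _ ->.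
- move=> gK gKl; split; last exact: map_f.
  by case/mapP: gKl => -[u [x y]] _ -> /=; apply: subgroupM.
- move=> h /Hev[w0 <-]; have [w rw <-] := reduced_word_exists w0.
  have [] := @few_factors_periodic _ _ (@reduced_word_factor G s) n
    (reduced_words s n) w _ few rw.
    by move=> u ru un; apply/mem_reduced_words.
  move=> u [x [y [k [wE un xn yn]]]].
  exists (coset_of (u, (x, y))).
    apply/map_f/allpairs_f; first exact/SP/(leq_trans un)/leq_pmull.
    by apply: allpairs_f; apply: SP; first exact/(leq_trans xn)/leq_pmull.
  rewrite wE !eval_word_cat /= (_ : eval_word (flatten _) = eval_word x ^+ k).
    rewrite invgM -!mulgA mulKg -conjgE conjXg.
    have xy := @sub_generated _ [set eval_word x ^ eval_word y] _ erefl.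
    exact: (subgroupX k (generated_is_subgroup _) xy).
  elim: k {wE} => [|k IH] /=; first by rewrite /eval_word big_nil.
  by rewrite eval_word_cat IH expgS.
by exists a => //; apply: finite_indexP => //; exact: generated_is_subgroup.
Qed.

End VirtuallyCyclic.

(** * Recursive bounds on the distortion *)

Section Recursive.

Definition recursive2 (op : nat -> nat -> nat) : Prop :=
  exists c : mu_code 2, forall a b, mu_eval c [tuple a; b] (op a b).

Lemma recursive_op2 op f g : recursive2 op -> recursive f -> recursive g ->
  recursive (fun r => op (f r) (g r)).
Proof.
move=> [c cP] [cf cfP] [cg cgP].
exists (Mu_comp c (fun i : 'I_2 => if i == ord0 then cf else cg)) => r /=.
exists [tuple f r; g r]; split=> // i.
by case: eqP => [->|/eqP]; last by case: i => -[|[|]]//= ?.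
Qed.

Lemma recursive_comp f g : recursive f -> recursive g -> recursive (f \o g).
Proof.
move=> [cf cfP] [cg cgP]; exists (Mu_comp cf (fun=> cg)) => r /=.
by exists [tuple g r]; split=> // i; rewrite (tnth_nth 0%N) ord1.
Qed.

Lemma recursive_id : recursive id.
Proof. by exists (Mu_proj ord0) => r. Qed.

Lemma recursiveS : recursive S.
Proof. by exists Mu_succ => r. Qed.

Lemma recursive_cst n : recursive (fun=> n).
Proof.
elim: n => [|n IH]; first by exists (Mu_zero 1).
exact: (recursive_comp recursiveS IH).
Qed.

Lemma mu_eval_rec n (f : mu_code n) (g : mu_code n.+2) (F : nat -> nat)
    (v : n.-tuple nat) :
  mu_eval f v (F 0%N) ->
  (forall k, mu_eval g [tuple of k :: F k :: v] (F k.+1)) ->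
  forall k, mu_eval (Mu_rec f g) [tuple of k :: v] (F k).
Proof.
move=> F0 FS k.
(* [mu_eval] takes the parameters as the tail of [k :: v], a tuple whose equality with [v] has to be
   proved; hence the generalization to [p]. *)
suff main p : p = v -> (fix iterate (k z : nat) : Prop :=
    match k with
    | 0%N => mu_eval f p z
    | k'.+1 => exists2 z', iterate k' z' & mu_eval g [tuple of k' :: z' :: p] z
    end) k (F k) by apply: main; exact: val_inj.
by move=> ->; elim: k => [//|k IH]; exists (F k).
Qed.

Lemma recursive2_addn : recursive2 addn.
Proof.
exists (Mu_rec (Mu_proj ord0 : mu_code 1)
  (Mu_comp Mu_succ (fun=> Mu_proj (inord 1 : 'I_3)))) => a b.
apply: (mu_eval_rec (F := addn^~ b)) => [|k] /=; first by rewrite (tnth_nth 0%N).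
exists [tuple (k + b)%N]; split=> // i.
by rewrite !(tnth_nth 0%N) inordK// ord1.
Qed.

Lemma recursive2_muln : recursive2 muln.
Proof.
have [c cP] := recursive2_addn.
exists (Mu_rec (Mu_zero 1) (Mu_comp c (fun i : 'I_2 =>
  if i == ord0 then Mu_proj (inord 2 : 'I_3) else Mu_proj (inord 1 : 'I_3)))).
move=> a b; apply: (mu_eval_rec (F := muln^~ b)) => [//|k].
exists [tuple b; (k * b)%N]; split=> [i|]; last exact: cP.
case: eqP => [->|/eqP]; first by rewrite /= !(tnth_nth 0%N) inordK.
by case: i => -[|[|]]//= ? _; rewrite !(tnth_nth 0%N) inordK.
Qed.

Lemma recursiveD f g : recursive f -> recursive g ->
  recursive (fun r => f r + g r)%N.
Proof. exact: recursive_op2 recursive2_addn. Qed.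

Lemma recursiveM f g : recursive f -> recursive g ->
  recursive (fun r => f r * g r)%N.
Proof. exact: recursive_op2 recursive2_muln. Qed.

End Recursive.

Section Distortion.
Local Open Scope group_scope.

Lemma generated1P (G : groupType) (a g : G) :
  generated [set a] g -> exists n, g = a ^+ n \/ g = a ^- n.
Proof.
move=> /generatedP[w aw <-]; elim: w aw => [|x w IH] aw.
  by exists 0%N; left; rewrite big_nil.
have [|n] := IH; first by move=> y yw; apply: aw; rewrite inE yw orbT.
have [->|/(canRL invgK) ->] := aw x (mem_head _ _); rewrite big_cons.
  case=> ->; first by exists n.+1; left; rewrite expgS.
  case: n => [|n]; first by exists 1%N; left; rewrite expg0 invg1 mulg1.
  by exists n; right; rewrite expgSr invgM mulVKg.
case=> ->; last by exists n.+1; right; rewrite expgSr invgM.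
case: n => [|n]; first by exists 1%N; right; rewrite expg0 mulg1 expg1.
by exists n; left; rewrite expgS mulKg.
Qed.

Lemma finite_index_cosets (G : groupType) (K H : set G) :
  is_subgroup K -> finite_index K H ->
  exists l : seq G, (forall t, t \in l -> H t) /\
    forall h, H h -> exists2 t, t \in l & K (t^-1 * h).
Proof.
move=> Ksub /finite_seqP[cs csE].
(* The implication makes the statement hold for every [C], as [choice] requires; outside [cs] the
   representative is a dummy [1]. *)
have repP C : exists t, C \in cs -> H t /\ left_coset t K = C.
  have [Ccs|_] := boolP (C \in cs); last by exists 1.
  have : [set` cs] C by [].
  by rewrite -csE => -[t Ht tC]; exists t.
have [rep {}repP] := choice repP.
exists [seq rep C | C <- cs]; split=> [_ /mapP[C /repP[Hr _] ->]//|h Hh].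
have hcs : left_coset h K \in cs.
  by have : [set left_coset h K | h in H] (left_coset h K) by [exists h]; rewrite csE.
exists (rep (left_coset h K)); first exact: map_f.
have [_ rE] := repP _ hcs.
have : left_coset h K h by exists 1; rewrite ?mulg1//; exact: subgroup1.
by move: (rep _) rE => t <- [k Kk <-]; rewrite mulKg.
Qed.

Variables (G : groupType) (X Y H : set G).
Hypotheses (genX : finite_generating_set X [set: G]) (Hsub : is_subgroup H).
Hypothesis genY : finite_generating_set Y H.

Let XT g : generated X g. Proof. by rewrite genX.2. Qed.

(* If n were larger, then the elements a^(i n + j) with i < c S and j < rho S,
   where S = N(4 rho c) + 1, would be pairwise distinct and would fill
   R^2 / (4 rho c) places in the relative ball of radius R = 2 rho c S. *)
Lemma exponent_bound (N : nat -> nat) (a : G) (c rho n : nat) :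
  (forall M r, (0 < M)%N -> (N M < r)%N -> (M * relative_growth X H r < r ^ 2)%N) ->
  H a -> (forall m, a ^+ m.+1 <> 1) -> (0 < c)%N -> (word_length X a <= c)%N ->
  (0 < rho)%N -> (word_length X (a ^+ n)%g <= rho)%N ->
  (n <= rho * (N (4 * rho * c)).+1)%N.
Proof.
move=> NP Ha a_inf c0 ac rho0 nrho; rewrite leqNgt; apply/negP.
set S := (N _).+1 => Sn.
have aI : injective (fun m => a ^+ m).
  move=> i j; wlog ij : i j / (i <= j)%N.
    by move=> hwlog eq; case: (leqP i j) => [/hwlog|/ltnW/hwlog]; [exact|move=> ->].
  rewrite -(subnK ij) expgnDr; case: (j - i)%N => [//|d] /esym/(canRL (mulgK _)).
  by rewrite mulgV => /a_inf.
pose l := [seq a ^+ m | m <-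
  [seq (i * n + j)%N | i <- iota 0 (c * S), j <- iota 0 (rho * S)]].
have sl : size l = ((c * S) * (rho * S))%N.
  by rewrite size_map size_allpairs !size_iota.
have : (size l <= relative_growth X H (2 * rho * c * S))%N.
  apply: leq_size_fset_set; first exact: finite_relative_ball.
    rewrite map_inj_uniq//; apply: allpairs_uniq; rewrite ?iota_uniq//.
    move=> [i j] [i' j'] /allpairsP[[i0 j0] /= [_ +]] [-> ->].
    rewrite mem_iota => /andP[_ j0S] /allpairsP[[i1 j1] /= [_ +]] [-> ->].
    rewrite mem_iota => /andP[_ j1S] eq.
    (* With [j < rho * S < n], the pair [i], [j] is the quotient and remainder of the exponent by
       [n]. *)
    have [jn j1n] : (j0 < n)%N /\ (j1 < n)%N by lia.
    have := congr1 (modn^~ n) eq; rewrite !modnMDl !modn_small// => jj.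
    move: eq; rewrite jj => /addIn/eqP.
    by rewrite eqn_pmul2r ?(leq_trans _ jn)// => /eqP ->.
  move=> _ /mapP[_ /allpairsP[[i j] /= [+ + ->]] ->].
  rewrite !mem_iota !add0n => /andP[_ iS] /andP[_ jS]; split.
    exact: subgroupX.
  rewrite expgnDr mulnC expgnA (leq_trans (word_lengthM _ _))//.
  rewrite (_ : 2 * rho * c * S = c * S * rho + rho * S * c)%N; last by lia.
  apply: leq_add; apply: (leq_trans (word_lengthX _ _)) => //.
    exact: leq_mul (ltnW iS) nrho.
  exact: leq_mul (ltnW jS) ac.
have := NP (4 * rho * c)%N (2 * rho * c * S)%N.
rewrite leq_pmull ?muln_gt0 ?rho0 ?c0// => /(_ isT isT).
rewrite sl; move: (relative_growth _ _ _) => g + gl.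
have : (4 * rho * c * (c * S * (rho * S)) <= 4 * rho * c * g)%N.
  by rewrite leq_mul2l gl orbT.
by rewrite -mulnn; lia.
Qed.

Lemma distortion_bounded_by_recursive (N : nat -> nat) : recursive N ->
  (forall M r, (0 < M)%N -> (N M < r)%N -> (M * relative_growth X H r < r ^ 2)%N) ->
  virtually_cyclic H -> bounded_by_recursive (distortion X Y H).
Proof.
move=> recN NP [a Ha /finite_index_cosets[|l [lH lP]]].
  exact: generated_is_subgroup.
have YH h : H h -> generated Y h by rewrite genY.2.
have [A A0 lA] := word_lengths_bounded Y l.
have [B B0 aB] := word_lengths_bounded Y [:: a].
have [c c0 ac] := word_lengths_bounded X [:: a].
have [tau tau0 ltau] := word_lengths_bounded X l.
have Ya := YH a Ha.
(* Every [h] in [H] is [t a^n] or [t a^-n] with [t] in the finite list [l], so its length over [Y]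
   is controlled by [n]. *)
have key h : H h -> exists t n, [/\ t \in l,
    (word_length X (a ^+ n)%g <= word_length X (t^-1 * h)%g)%N &
    (word_length Y h <= A + word_length Y (a ^+ n)%g)%N].
  move=> /lP[t tl /generated1P[n tn]]; exists t, n; split => //.
    by case: tn => ->//; rewrite -{1}[a ^+ n]invgK word_lengthV.
  have Yan := YH _ (subgroupX n Hsub Ha).
  have [v vn [-> vY]] : exists2 v, v = t^-1 * h & h = t * v /\
      generated Y v /\ (word_length Y v <= word_length Y (a ^+ n)%g)%N.
    exists (t^-1 * h); rewrite ?mulVKg//; split=> //; case: tn => ->; split=> //.
      exact: subgroupV (generated_is_subgroup _) Yan.
    exact: word_lengthV.
  rewrite (leq_trans (word_lengthM (YH _ (lH _ tl)) vY.1))//.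
  by apply: leq_add vY.2; exact: lA.
have bnd f : recursive f -> (forall r h, H h -> (word_length X h <= r)%N ->
    (word_length Y h <= f r)%N) -> bounded_by_recursive (distortion X Y H).
  move=> recf fP; exists f => // r _; apply/bigmax_leqP_seq => h + _.
  rewrite in_fset_set; last exact: finite_relative_ball.
  by rewrite inE => -[Hh hr]; exact: fP.
(* If [a] has finite order, exponents reduce modulo [m.+1] and a constant bound suffices. *)
have [[m am]|a_inf] := pselect (exists m, a ^+ m.+1 = 1).
  apply: (bnd (fun=> A + m.+1 * B)%N); first exact: recursive_cst.
  move=> r h Hh _; have [t [n [_ _ hn]]] := key h Hh.
  rewrite (leq_trans hn)// leq_add2l (divn_eq n m.+1) expgnDr mulnC expgnA am.
  rewrite expg1n mul1g (leq_trans (word_lengthX _ _))// leq_mul//.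
    exact/ltnW/ltn_pmod.
  by apply: aB; exact: mem_head.
(* For [h] of length at most [r], [rho r] bounds the length of [t^-1 h], hence of [a^n]. It is
   positive because [tau] is, as [exponent_bound] requires. *)
pose rho r := (r + tau)%N.
apply: (bnd (fun r => A + (rho r * (N (4 * c * rho r)).+1) * B)%N).
  have rec_rho : recursive rho by exact: recursiveD recursive_id (recursive_cst _).
  apply: recursiveD; first exact: recursive_cst.
  apply: recursiveM; last exact: recursive_cst.
  apply: (recursiveM rec_rho); apply: (recursive_comp recursiveS).
  apply: (recursive_comp recN); exact: recursiveM (recursive_cst (4 * c)) rec_rho.
move=> r h Hh hr; have [t [n [tl nX hn]]] := key h Hh.
rewrite (leq_trans hn)// leq_add2l (leq_trans (word_lengthX _ Ya))//.
apply: leq_mul; last by apply: aB; exact: mem_head.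
rewrite mulnAC; apply: (exponent_bound (a := a)) => //.
- by move=> m am; apply: a_inf; exists m.
- by apply: ac; exact: mem_head.
- by rewrite /rho; lia.
rewrite (leq_trans nX)// (leq_trans (word_lengthM _ _))// addnC leq_add//.
by rewrite (leq_trans (word_lengthV _))// ltau.
Qed.

End Distortion.

(** * An enumeration of the recursive functions *)

Section Enumeration.

Lemma mu_eval_det n (c : mu_code n) v y z :
  mu_eval c v y -> mu_eval c v z -> y = z.
Proof.
elim: c v y z => {n}
  [n v y z -> ->//|v y z -> ->//|n i v y z -> ->//
  |m n f IHf g IHg v y z [w [gw fw]] [w' [gw' fw']]
  |n f IHf g IHg v y z /=|n f IHf v y z [fy miny] [fz minz]].
- have ww' : w = w' by apply: eq_from_tnth => i; exact: IHg (gw i) (gw' i).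
  by rewrite -ww' in fw'; exact: IHf fw fw'.
- elim: (thead v) y z => [|k IH] y z; first exact: IHf.
  by move=> [y' /IH y'E gy] [z' /y'E <- gz]; exact: IHg gy gz.
- by have [/minz[k /(IHf _ _ _ fy)]|/miny[k /(IHf _ _ _ fz)]|] := ltngtP y z.
Qed.

(* [fuel] only bounds the recursion depth; invalid numbers decode to zero. *)
Fixpoint mu_decode (fuel x n : nat) : mu_code n :=
  if fuel is d.+1 then
    match CodeSeq.decode x with
    | [:: 1] => match n with 1 => Mu_succ | _ => Mu_zero _ end
    | [:: 2; i] => if insub i is Some j then Mu_proj j else Mu_zero n
    | [:: 3, m, cf & cg] =>
        Mu_comp (mu_decode d cf m) (fun i : 'I_m => mu_decode d (nth 0%N cg i) n)
    | [:: 4; cf; cg] =>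
        match n with
        | n'.+1 => Mu_rec (mu_decode d cf n') (mu_decode d cg n'.+2)
        | 0 => Mu_zero 0
        end
    | [:: 5; cf] => Mu_min (mu_decode d cf n.+1)
    | _ => Mu_zero n
    end
  else Mu_zero n.

(** Allowing every fuel [d'] above [d] lets the subcodes share the maximum of their fuels. *)
Lemma mu_decode_surj n (c : mu_code n) :
  exists d x, forall d', (d <= d')%N -> mu_decode d' x n = c.
Proof.
have code s : exists x, CodeSeq.decode x = s.
  by exists (CodeSeq.code s); rewrite CodeSeq.codeK.
elim: c => {n} [n||n i|m n f [df [xf fE]] g IHg|n f [df [xf fE]] g [dg [xg gE]]
  |n f [df [xf fE]]].
- by have [x xE] := code [::]; exists 0%N, x => -[|d] _ //=; rewrite xE.
- by have [x xE] := code [:: 1%N]; exists 1%N, x => -[|d] _ //=; rewrite xE.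
- have [x xE] := code [:: 2; val i]%N; exists 1%N, x => -[|d] _ //=.
  by rewrite xE valK.
- have [dg {}IHg] := choice IHg; have [xg gE] := choice IHg.
  have [x xE] := code [:: 3, m, xf & [seq xg i | i <- enum 'I_m]]%N.
  exists (maxn df (\max_i dg i)).+1, x => -[//|d].
  rewrite ltnS geq_max => /andP[dfd dgd] /=.
  rewrite xE fE//; congr Mu_comp; apply/funext => i.
  rewrite (nth_map i) ?size_enum_ord// nth_ord_enum gE//.
  exact: leq_trans (leq_bigmax i) dgd.
- have [x xE] := code [:: 4; xf; xg]%N.
  exists (maxn df dg).+1, x => -[//|d].
  rewrite ltnS geq_max => /andP[dfd dgd] /=.
  by rewrite xE fE// gE.
- have [x xE] := code [:: 5; xf]%N; exists df.+1, x => -[//|d] /= dfd.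
  by rewrite xE fE.
Qed.

(** An index encodes a pair of a fuel and a number. If the decoded code is total, it determines its
    function because evaluation is deterministic; otherwise [id] is a dummy. The enumeration itself
    is not claimed to be recursive. *)
Lemma recursive_enumeration :
  exists e : nat -> nat -> nat, forall f, recursive f -> exists j, e j =1 f.
Proof.
have /choice[e eP] : forall j : nat * nat, exists F : nat -> nat, forall f,
    (forall n, mu_eval (mu_decode j.1 j.2 1) [tuple n] (f n)) -> F =1 f.
  move=> j; have [[F FP]|no] := pselect (exists F : nat -> nat,
      forall n, mu_eval (mu_decode j.1 j.2 1) [tuple n] (F n)).
    by exists F => f fP n; exact: mu_eval_det (FP n) (fP n).
  by exists id => f fP; case: no; exists f.
exists (fun k : nat => e (odflt (0, 0)%N (@choice.unpickle (nat * nat)%type k))).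
move=> f [c cP].
have [d [x dx]] := mu_decode_surj c.
exists (choice.pickle (d, x)); rewrite choice.pickleK /=; apply: eP => n /=.
by rewrite dx.
Qed.

End Enumeration.

(** * A group with nonrecursive distortion *)

Record invertible_action := InvertibleAction {
  letter : finType;
  point : Type;
  letter_inv : letter -> letter;
  act : letter -> point -> point;
  actK : forall l, cancel (act l) (act (letter_inv l));
  actKV : forall l, cancel (act (letter_inv l)) (act l)
}.

Section TransformationGroup.
Variable A : invertible_action.
Implicit Types w : seq (letter A).

Definition act_word w : point A -> point A := foldr (fun l f => act l \o f) id w.

Definition act_word_inv w := rev [seq letter_inv l | l <- w].

Lemma act_word_cat u v : act_word (u ++ v) = act_word u \o act_word v.
Proof. by elim: u => //= l u ->. Qed.

Lemma act_wordK w : cancel (act_word w) (act_word (act_word_inv w)).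
Proof.
elim: w => [//|l w IH] x.
by rewrite /act_word_inv /= rev_cons -cats1 act_word_cat /= actK IH.
Qed.

Lemma act_wordKV w : cancel (act_word (act_word_inv w)) (act_word w).
Proof.
elim: w => [//|l w IH] x.
by rewrite /act_word_inv /= rev_cons -cats1 act_word_cat /= IH actKV.
Qed.

(* Only the transformations induced by words, so that the letters generate. *)
Definition transformation := {f : point A -> point A | exists w, f = act_word w}.

HB.instance Definition _ := gen_eqMixin transformation.
HB.instance Definition _ := gen_choiceMixin transformation.

Definition transf_of_word w : transformation := exist _ _ (ex_intro _ w erefl).

Lemma transf_eq (g h : transformation) : sval g =1 sval h -> g = h.
Proof.
case: g h => [g gw] [h hw] /= /funext gh; rewrite gh in gw *.
by congr exist; exact: Prop_irrelevance.
Qed.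

Lemma transf_word (g : transformation) : exists w, g = transf_of_word w.
Proof. by case: g => g [w gw]; exists w; apply: transf_eq => x /=; rewrite gw. Qed.

Let transf_mul_subproof (g h : transformation) :
  exists w, sval g \o sval h = act_word w.
Proof.
have [[u gu] [v hv]] := (svalP g, svalP h).
by exists (u ++ v); rewrite act_word_cat gu hv.
Qed.

Definition transf_mul (g h : transformation) : transformation :=
  exist _ _ (transf_mul_subproof g h).

Definition transf_inv (g : transformation) : transformation :=
  transf_of_word (act_word_inv (projT1 (cid (svalP g)))).

Let transf_mulA : associative transf_mul.
Proof. by move=> f g h; exact: transf_eq. Qed.

Let transf_mul1 : left_id (transf_of_word [::]) transf_mul.
Proof. by move=> f; exact: transf_eq. Qed.

Let transf_mulr1 : right_id (transf_of_word [::]) transf_mul.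
Proof. by move=> f; exact: transf_eq. Qed.

Let transf_mulV : left_inverse (transf_of_word [::]) transf_inv transf_mul.
Proof.
move=> f; apply: transf_eq => x /=; case: cid => w fw /=.
by rewrite [sval f]fw act_wordK.
Qed.

Let transf_mulrV : right_inverse (transf_of_word [::]) transf_inv transf_mul.
Proof.
move=> f; apply: transf_eq => x /=; case: cid => w fw /=.
by rewrite [sval f]fw act_wordKV.
Qed.

HB.instance Definition _ := isGroup.Build transformation
  transf_mulA transf_mul1 transf_mulr1 transf_mulV transf_mulrV.

End TransformationGroup.

Section LetterGenerators.
Variable A : invertible_action.
Local Open Scope group_scope.
Implicit Types w : seq (letter A).

Definition letter_gens : set (transformation A) :=
  [set transf_of_word [:: l] | l in [set: letter A]].

Lemma sval_mul (g h : transformation A) x : sval (g * h) x = sval g (sval h x).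
Proof. by []. Qed.

Lemma transf_of_word_cat u v :
  transf_of_word (u ++ v) = transf_of_word u * transf_of_word v :> transformation A.
Proof. by apply: transf_eq => x /=; rewrite act_word_cat. Qed.

Lemma prod_letters w :
  \prod_(x <- [seq transf_of_word [:: l] | l <- w]) x = transf_of_word w.
Proof.
elim: w => [|l w IH] /=; first by rewrite big_nil.
by rewrite big_cons IH -transf_of_word_cat.
Qed.

Lemma letter_word_over w :
  word_over letter_gens [seq transf_of_word [:: l] | l <- w].
Proof. by move=> _ /mapP[l _ ->]; left; exists l. Qed.

Lemma letter_gens_generate :
  finite_generating_set letter_gens [set: transformation A].
Proof.
split; first exact/finite_image/finite_finset.
apply/seteqP; split=> // g _; have [w ->] := transf_word g.
by apply/generatedP; exists [seq transf_of_word [:: l] | l <- w];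
  [exact: letter_word_over | exact: prod_letters].
Qed.

Lemma word_length_transf w :
  (word_length letter_gens (transf_of_word w) <= size w)%N.
Proof.
rewrite -prod_letters -(size_map (fun l => transf_of_word [:: l]) w).
exact/word_length_le/letter_word_over.
Qed.

(** The inverse of a generator is again given by a letter, so a shortest word over generators and
    inverses can be spelled with as many letters. *)
Lemma word_length_transfP (g : transformation A) :
  exists2 w, size w = word_length letter_gens g & g = transf_of_word w.
Proof.
have [|ws [wsX <- <-]] := @word_lengthP _ letter_gens g.
  by rewrite letter_gens_generate.2.
elim: ws wsX => [|x ws IH] wsX; first by exists [::]; rewrite ?big_nil.
have [|w sw wE] := IH; first by move=> y yws; apply: wsX; rewrite inE yws orbT.
rewrite big_cons wE.
have [[l _ <-]|[l _ lx]] := wsX x (mem_head _ _).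
  by exists (l :: w); rewrite /= ?sw// -transf_of_word_cat.
exists (letter_inv l :: w); first by rewrite /= sw.
rewrite -cat1s transf_of_word_cat -(invgK x) -lx; congr (_ * _).
by apply: mulg1_eq; apply: transf_eq => y /=; rewrite actKV.
Qed.

End LetterGenerators.

(** * The group of reflections of lines, and lengths in it *)

Section MirrorGroup.
Variables R N : nat -> nat.
Hypothesis R_lt : forall k, (R k < R k.+1)%N.
Local Open Scope ring_scope.

Lemma R_ltn : {homo R : i j / (i < j)%N}.
Proof. exact: (homo_ltn ltn_trans R_lt). Qed.

Lemma R_inj : injective R.
Proof.
move=> i j eqR; have [/R_ltn|/R_ltn|//] := ltngtP i j; rewrite eqR ltnn//.
Qed.

Definition mirror (j x : int) : int :=
  if pselect (exists k, j == (R k)%:Z) is left ex then (N (xchoose ex))%:Z - x else x.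

Lemma mirror_at k x : mirror (R k)%:Z x = (N k)%:Z - x.
Proof.
rewrite /mirror; case: pselect => [ex|[]]; last by exists k.
by have /eqP[/R_inj <-] := xchooseP ex.
Qed.

Variant mirror_spec (j x : int) : int -> Type :=
| MirrorAt k of j = (R k)%:Z : mirror_spec j x ((N k)%:Z - x)
| MirrorOff of (forall k, j <> (R k)%:Z) : mirror_spec j x x.

Lemma mirrorP j x : mirror_spec j x (mirror j x).
Proof.
rewrite /mirror; case: pselect => [ex|nex].
  by apply: MirrorAt; apply/eqP; exact: (xchooseP ex).
by apply: MirrorOff => k jk; apply: nex; exists k; rewrite jk.
Qed.

Lemma mirrorK j : involutive (mirror j).
Proof.
move=> x; case: mirrorP => [k ->|]; first by rewrite mirror_at; lia.
by case: mirrorP => // k jk /(_ k).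
Qed.

(* Letters: [(0, b)] moves along the line, [(1, b)] applies the mirror of the
   current position, and at position 0 [(2, b)] is the reflection at 0 and
   [(3, b)] the translation by 1; b selects the inverse. *)
Definition mirror_act (l : 'I_4 * bool) (p : int * int) : int * int :=
  let: (j, x) := p in
  match val l.1 with
  | 0 => (if l.2 then j - 1 else j + 1, x)
  | 1 => (j, mirror j x)
  | 2 => (j, if j == 0 then - x else x)
  | _ => (j, if j == 0 then (if l.2 then x - 1 else x + 1) else x)
  end.

Lemma mirror_actK l : cancel (mirror_act l) (mirror_act (l.1, ~~ l.2)).
Proof.
case: l => -[i i4] b [j x] /=.
case: i i4 => [|[|[|i]]] _ /=.
- by congr pair; case: b => /=; lia.
- by rewrite mirrorK.
- by congr pair; case: eqP; lia.
- by congr pair; case: eqP; case: b => /=; lia.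
Qed.

Lemma mirror_actKV l : cancel (mirror_act (l.1, ~~ l.2)) (mirror_act l).
Proof. by case: l => i []; exact: (@mirror_actK (i, _)). Qed.

Definition mirror_action := InvertibleAction mirror_actK mirror_actKV.

Definition mirror_group := transformation mirror_action.

Definition shift_letter b : letter mirror_action := (inord 0, b).
Definition mirror_letter : letter mirror_action := (inord 1, false).
Definition flip_letter : letter mirror_action := (inord 2, false).
Definition step_letter : letter mirror_action := (inord 3, false).

Definition mirror_gen : mirror_group := transf_of_word [:: step_letter].

Lemma gen_expE n (j x : int) :
  sval (mirror_gen ^+ n)%g (j, x) = (j, if j == 0 then x + n%:Z else x).
Proof.
elim: n x => [|n IH] x; first by rewrite expg0 /=; case: eqP; rewrite ?addr0.
rewrite expgSr /= inordK//= IH; case: eqP => // _.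
by rewrite -addn1 PoszD; congr pair; lia.
Qed.

Lemma gen_expVE n (j x : int) :
  sval (mirror_gen ^- n)%g (j, x) = (j, if j == 0 then x - n%:Z else x).
Proof.
have : sval (mirror_gen ^- n * mirror_gen ^+ n)%g (j, if j == 0 then x - n%:Z else x) =
    (j, if j == 0 then x - n%:Z else x) by rewrite mulVg.
by rewrite /= gen_expE => <-; case: (j == 0); rewrite ?subrK.
Qed.

Lemma word_length_exp_gen k :
  (word_length (@letter_gens mirror_action) (mirror_gen ^+ (2 * N k))%g
    <= 4 * R k + 4)%N.
Proof.
pose v := nseq (R k) (shift_letter true) ++ mirror_letter ::
  nseq (R k) (shift_letter false) ++ [:: flip_letter].
have -> : (mirror_gen ^+ (2 * N k))%g = transf_of_word (v ++ v).
  apply: transf_eq => -[j x]; rewrite gen_expE.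
  have shiftE b m p : act_word (nseq m (shift_letter b)) p =
      (if b then p.1 - m%:Z else p.1 + m%:Z, p.2).
    elim: m p => [|m IH] [i y] /=; first by case: (b); rewrite ?subr0 ?addr0.
    by rewrite IH /= inordK//=; congr pair; case: (b) => /=; lia.
  have vE i y : act_word v (i, y) =
      (i, mirror (i + (R k)%:Z) (if i == 0 then - y else y)).
    rewrite /v act_word_cat /= act_word_cat /= shiftE/= shiftE /= !inordK//=.
    by congr pair; lia.
  rewrite /= act_word_cat /= !vE; congr pair; have [->|j0] := eqVneq j 0.
    by rewrite !add0r !mirror_at PoszM; lia.
  by rewrite mirrorK.
rewrite (leq_trans (word_length_transf _))// /v !size_cat /= !size_cat.
by rewrite !size_nseq /=; lia.
Qed.

Lemma word_length_gen_exp n :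
  (n <= word_length [set mirror_gen] (mirror_gen ^+ n)%g)%N.
Proof.
have gen_n : generated [set mirror_gen] (mirror_gen ^+ n)%g.
  have := @sub_generated _ [set mirror_gen] mirror_gen erefl.
  exact: (subgroupX n (generated_is_subgroup _)).
have [w [wg <- wn]] := word_lengthP gen_n.
suff [z wz zw] : exists2 z : int,
    forall x, sval (\prod_(y <- w) y)%g (0, x) = (0, x + z) & `|z| <= (size w)%:Z.
  have := congr1 snd (wz 0); rewrite wn gen_expE /= !add0r => nz.
  by move: zw; rewrite -nz.
elim: w wg {wn} => [|y w IH] wg.
  by exists 0 => // x; rewrite big_nil /= addr0.
have [|z wz zw] := IH; first by move=> y' y'w; apply: wg; rewrite inE y'w orbT.
have [->|yV] := wg y (mem_head _ _).
  exists (z + 1) => [x|]; last first.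
    by move: zw; rewrite [size (_ :: _)]/=; move: (size w) => m; lia.
  by rewrite big_cons sval_mul wz -[mirror_gen]expg1 gen_expE addrA.
exists (z - 1) => [x|]; last first.
  by move: zw; rewrite [size (_ :: _)]/=; move: (size w) => m; lia.
have -> : y = (mirror_gen ^- 1)%g by rewrite expg1 -yV invgK.
by rewrite big_cons sval_mul wz gen_expVE addrA.
Qed.

Hypothesis N_le : forall k, (N k <= N k.+1)%N.
Hypothesis N_gt0 : (0 < N 0)%N.

Lemma N_leq : {homo N : i j / (i <= j)%N}.
Proof. exact: (homo_leq leqnn leq_trans N_le). Qed.

Lemma N_pos k : (0 < N k)%N.
Proof. exact: leq_trans N_gt0 (N_leq (leq0n k)). Qed.

Section LowerBound.
Variable k : nat.
Let D : int := (R k.+1)%:Z - (R k)%:Z.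

(** The height of [j] above [R k], truncated to [[0, D]]: a potential that one move changes by at
    most 1 and that records the travel between the mirrors at [R k] and [R k.+1]. *)
Let height (j : int) : int :=
  if j <= (R k)%:Z then 0 else if j <= (R k.+1)%:Z then j - (R k)%:Z else D.

(* Below position R k.+2 the second coordinate is x = M + l N k.+1, where only
   mirrors at most at R k contribute to M. The mirror at R k.+1 fixes |2l - 1|,
   the lower reflections fix |2l|, and alternating between them costs D moves. *)
Lemma orbit_bound (w : seq (letter mirror_action)) : (size w < R k.+2)%N ->
  exists M l : int, let: (j, x) := act_word w (0, 0) in
    [/\ x = M + l * (N k.+1)%:Z, `|M| <= (size w * N k)%:Z, `|j| <= (size w)%:Z,
      D * `|2 * l| <= (size w)%:Z + height j &
      D * `|2 * l - 1| <= (size w)%:Z + D - height j].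
Proof.
have D0 : 0 < D by rewrite /D; have := R_lt k; lia.
have N0 := N_pos k.
elim: w => [_|a w IH] /=.
  exists 0, 0; rewrite mul0r !mulr0 sub0r normrN1 mulr1 /height le0z_nat.
  by split=> //; lia.
move=> wR; have [|M [l]] := IH; first exact: ltnW.
case: (act_word w (0, 0)) => j x; move: (size w) wR => n nR [xE Mn jn A B] {IH w}.
have height_low i : i <= (R k)%:Z -> height i = 0 by rewrite /height => ->.
have height_high : height (R k.+1)%:Z = D.
  by rewrite /height lexx; case: ifP => //; have := R_lt k; lia.
have MD : ((n.+1 * N k)%:Z = (n * N k)%:Z + (N k)%:Z) by lia.
have height_lip i i' : `|i - i'| <= 1 -> height i <= height i' + 1.
  by rewrite /height /D => ii'; do !case: ifP => ?; lia.
have idle : exists M0 l0 : int, [/\ x = M0 + l0 * (N k.+1)%:Z,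
   `|M0| <= (n.+1 * N k)%:Z, `|j| <= n.+1%:Z,
   D * `|2 * l0| <= n.+1%:Z + height j
   & D * `|2 * l0 - 1| <= n.+1%:Z + D - height j].
  by exists M, l; split=> //; lia.
(* A lower reflection turns [M] into [c - M] and [l] into [- l]. It keeps [|2l|], and the new
   [|2l - 1|] is at most [|2l| + 1], which the bound allows at height 0. *)
have lower (c y : int) : `|c| <= (N k)%:Z -> j <= (R k)%:Z -> y = c - x ->
   exists M0 l0 : int, [/\ y = M0 + l0 * (N k.+1)%:Z,
   `|M0| <= (n.+1 * N k)%:Z, `|j| <= n.+1%:Z,
   D * `|2 * l0| <= n.+1%:Z + height j
   & D * `|2 * l0 - 1| <= n.+1%:Z + D - height j].
  move=> cN jR ->; exists (c - M), (- l); rewrite height_low// in A B *.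
  split; [by rewrite xE mulNr; lia | by lia | by lia | by rewrite mulrN normrN; lia |].
  have : D * `|2 * - l - 1| <= D * (`|2 * l| + 1) by rewrite ler_pM2l//; lia.
  by rewrite mulrDr mulr1; lia.
case: a => -[i i4] b; case: i i4 => [|[|[|i]]] _ /=.
- exists M, l; have h1 := height_lip (if b then j - 1 else j + 1) j.
  have h2 := height_lip j (if b then j - 1 else j + 1).
  by split=> //; case: b h1 h2 => h1 h2; lia.
- case: mirrorP => [m jm|_]; last exact: idle.
  have [mk|mk|mk] := ltngtP m k.+1.
  + apply: (lower (N m)) => //; first by have /N_leq : (m <= k)%N by []; lia.
    have : (R m <= R k)%N; [|lia].
    by move: mk; rewrite ltnS leq_eqVlt => /orP[/eqP ->//|/R_ltn/ltnW].
  (* A word shorter than [R k.+2] cannot reach a mirror beyond [R k.+1]. *)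
  + exfalso; have : (R k.+2 <= R m)%N; [|lia].
    by move: mk; rewrite leq_eqVlt => /orP[/eqP ->//|/R_ltn/ltnW].
  (* Here [l] becomes [1 - l], which keeps [|2l - 1|]; the new [|2l|] is at most [|2l - 1| + 1],
     which the bound allows at height [D]. *)
  + exists (- M), (1 - l); rewrite jm mk height_high in A B *; split.
    * by rewrite xE; lia.
    * by rewrite normrN; lia.
    * by rewrite -mk -jm; lia.
    * have : D * `|2 * (1 - l)| <= D * (`|2 * l - 1| + 1) by rewrite ler_pM2l//; lia.
      by rewrite mulrDr mulr1; lia.
    * by rewrite (_ : 2 * (1 - l) - 1 = - (2 * l - 1)) ?normrN; lia.
- case: eqP => [j0|_]; last exact: idle.
  by apply: (lower 0); rewrite ?j0 ?sub0r//; lia.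
- case: eqP => [j0|_]; last exact: idle.
  exists (if b then M - 1 else M + 1), l.
  by split; rewrite ?xE; case: b; lia.
Qed.

End LowerBound.

End MirrorGroup.

Definition int_range (b : nat) : seq int :=
  [seq (i%:Z - b%:Z)%R | i <- iota 0 (2 * b).+1].

Lemma mem_int_range b (z : int) : (`|z| <= b%:Z)%R -> z \in int_range b.
Proof.
move=> zb; apply/mapP; exists (absz (z + b%:Z)%R); last by lia.
by rewrite mem_iota; lia.
Qed.

(** * Growth and distortion of the cyclic subgroup generated by the step *)

Section MirrorGrowth.
Variables R N : nat -> nat.
Hypothesis R_step : forall k, R k.+1 = (R k + k.+1 * N k)%N.
Hypothesis N_le : forall k, (N k <= N k.+1)%N.
Hypothesis N_gt0 : (0 < N 0)%N.

Let R_lt k : (R k < R k.+1)%N.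
Proof. by rewrite R_step; have := N_pos N_le N_gt0 k; nia. Qed.

Let X := @letter_gens (mirror_action N R_lt).
Let H : set (mirror_group N R_lt) := generated [set mirror_gen N R_lt].

Lemma mirror_growth k r : (R k.+1 <= r < R k.+2)%N ->
  (k.+1 * relative_growth X H r <= 6 * r ^ 2)%N.
Proof.
move=> /andP[Rr rR]; have N0 := N_pos N_le N_gt0 k.
pose D := (k.+1 * N k)%N; have D0 : (0 < D)%N by rewrite muln_gt0.
have Dr : (D <= r)%N by rewrite (leq_trans _ Rr)// R_step leq_addl.
(* Candidates for the image of the origin, which determines an element of [H]. *)
pose l : seq int := [seq (M + c * (N k.+1)%:Z)%R | M <- int_range (r * N k),
                                      c <- int_range (r %/ (2 * D))].
have exp_val h : H h -> exists z : int, forall j x : int,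
    sval h (j, x) = (j, if j == 0 then (x + z)%R else x).
  move=> /generated1P[n [->|->]]; [exists n%:Z%R|exists (- n%:Z)%R] => j x.
    by rewrite gen_expE.
  by rewrite gen_expVE.
have : (relative_growth X H r <= size l)%N.
  apply: (@fset_set_leq_size _ _ (fun h : mirror_group N R_lt => (sval h (0, 0)%R).2)).
  - exact/finite_relative_ball/letter_gens_generate.
  - move=> g h; rewrite !inE => -[/exp_val[y gE] _] [/exp_val[z hE] _].
    rewrite gE hE /= !add0r => yz; apply: transf_eq => -[j x].
    by rewrite gE hE yz.
  move=> h [/exp_val[z hE]]; have [w <- hw] := word_length_transfP h => wr.
  have [|M [c]] := @orbit_bound _ _ R_lt N_le N_gt0 k w.
    exact: leq_ltn_trans wr rR.
  rewrite -[act_word w]/(sval (transf_of_word w)) -hw hE eqxx => -[-> Mw _ cD _].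
  apply: (allpairs_f (fun M c : int => (M + c * (N k.+1)%:Z)%R)); apply: mem_int_range.
    by rewrite (le_trans Mw)// lez_nat leq_mul2r wr orbT.
  have : (2 * D * absz c <= r)%N.
    have DE : ((R k.+1)%:Z - (R k)%:Z)%R = D%:Z%R by rewrite R_step -/D; lia.
    move: cD; rewrite DE le0z_nat addr0.
    rewrite (_ : `|2 * c|%R = (2 * absz c)%N%:Z%R); last by lia.
    by rewrite -PoszM lez_nat => /leq_trans/(_ wr); rewrite mulnCA mulnA.
  by move=> cr; rewrite -abszE lez_nat leq_divRL ?muln_gt0// mulnC.
rewrite size_allpairs !size_map !size_iota.
have := leq_divM r (2 * D); move: (r %/ _)%N => q qD.
move: (relative_growth _ _ _) => g gq.
(* From [2 * D * q <= r] and [D <= r]. The factor [k.+1] is then absorbed by [D = k.+1 * N k], and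
   the product is at most [3 r * 2 r]. *)
have qD' : (D * (2 * q).+1 <= 2 * r)%N by nia.
have : (k.+1 * g <= k.+1 * ((2 * (r * N k)).+1 * (2 * q).+1))%N.
  by rewrite leq_mul2l gq orbT.
have : (k.+1 * (2 * (r * N k)).+1 <= 3 * r * D)%N by rewrite /D; nia.
rewrite -mulnn; nia.
Qed.

Lemma mirror_subquadratic M : (0 < M)%N ->
  exists r0, forall r, (r0 < r)%N -> (M * relative_growth X H r < r ^ 2)%N.
Proof.
move=> M0; exists (R (6 * M).+2) => r Rr.
have idR n : (n <= R n)%N by elim: n => // n IH; exact: leq_ltn_trans (R_lt n).
have exR : exists n, (r < R n)%N by exists r.+1; exact: idR.
(* The least [m] is [k.+2] with [R k.+1 <= r < R k.+2] and [6 * M < k]; one unit beyond [6 * M]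
   makes the final inequality strict. *)
case: (ex_minnP exR) => m rm mmin.
have mM : ((6 * M).+2 < m)%N.
  rewrite ltnNge; apply/negP; rewrite leq_eqVlt.
  move=> /orP[/eqP mE|/(R_ltn R_lt)]; last by lia.
  by rewrite mE in rm; lia.
case: m rm mmin mM => [|[|k]] // rk kmin kM.
have Rkr : (R k.+1 <= r)%N by rewrite leqNgt; apply/negP => /kmin; rewrite ltnn.
have := @mirror_growth k r; rewrite Rkr rk => /(_ isT).
move: (relative_growth _ _ _) => g gr.
have : ((6 * M).+1 * g <= k.+1 * g)%N by rewrite leq_mul2r; apply/orP; right; lia.
have : (0 < r ^ 2)%N by rewrite expn_gt0; apply/orP; left; lia.
by move: (r ^ 2)%N gr => s; nia.
Qed.

Lemma mirror_distortion k :
  (2 * N k <= distortion X [set mirror_gen N R_lt] H (4 * R k + 4))%N.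
Proof.
rewrite (leq_trans (@word_length_gen_exp R N R_lt (2 * N k)))// /distortion.
apply: leq_bigmax_seq => //.
rewrite in_fset_set; last exact/finite_relative_ball/letter_gens_generate.
rewrite inE; split; last exact: word_length_exp_gen.
have := @sub_generated _ [set mirror_gen N R_lt] _ erefl.
exact: (subgroupX _ (generated_is_subgroup _)).
Qed.

Lemma mirror_generating :
  [/\ finite_generating_set X [set: mirror_group N R_lt], is_subgroup H &
      finite_generating_set [set mirror_gen N R_lt] H].
Proof.
split; first exact: letter_gens_generate.
  exact: generated_is_subgroup.
by split=> //; exact: finite_set1.
Qed.

End MirrorGrowth.

(** [R k.+1] depends only on [R k] and [N k], so [N k.+1] can be chosen afterwards, beyond the value
    of [e k] at [4 * R k.+1 + 4]. *)
Lemma dominating_parameters (e : nat -> nat -> nat) :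
  exists R N : nat -> nat, [/\ forall k, R k.+1 = (R k + k.+1 * N k)%N,
    forall k, (N k <= N k.+1)%N, (0 < N 0)%N &
    forall j, (e j (4 * R j.+1 + 4) < 2 * N j.+1)%N].
Proof.
pose next k (RN : nat * nat) := let R' := (RN.1 + k.+1 * RN.2)%N in
  (R', RN.2 + (e k (4 * R' + 4)).+1)%N.
pose RN := fix RN k := if k is k'.+1 then next k' (RN k') else (1, 1)%N.
exists (fun k => (RN k).1), (fun k => (RN k).2); split=> //= k; lia.
Qed.

Lemma subquadratic_growth_nonrecursive_distortion :
  exists (G : groupType) (X Y H : set G),
    [/\ finite_generating_set X [set: G], is_subgroup H,
        finite_generating_set Y H,
        forall M, (0 < M)%N -> exists r0, forall r, (r0 < r)%N ->
          (M * relative_growth X H r < r ^ 2)%N &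
        ~ bounded_by_recursive (distortion X Y H)].
Proof.
have [e eP] := recursive_enumeration.
have [R [N [R_step N_le N_gt0 dom]]] := dominating_parameters e.
have [genX Hsub genY] := mirror_generating R_step N_le N_gt0.
do 4!eexists; split; [exact: genX|exact: Hsub|exact: genY| |].
  exact: mirror_subquadratic.
(* Diagonal argument: the bound [f] is the function [e j], and it fails at the radius
   [4 * R j.+1 + 4]. *)
move=> [f /eP[j ej] fP].
have := fP (4 * R j.+1 + 4)%N; rewrite addn_gt0 orbT => /(_ isT).
have := dom j; rewrite ej.
have := mirror_distortion R_step N_le N_gt0 j.+1.
lia.
Qed.

(** * Assembly of the three statements from their integer forms *)

Local Open Scope ring_scope.

Theorem theorem2p6 (R : realType) :
  (forall (G : groupType) (X Y H : set G),
     finite_generating_set X [set: G] ->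
     is_subgroup H -> finite_generating_set Y H ->
     is_o (fun r => (relative_growth X H r)%:R : R) (fun r => r%:R ^+ 2) ->
     virtually_cyclic H)
  /\
  (forall (G : groupType) (X Y H : set G),
     finite_generating_set X [set: G] ->
     is_subgroup H -> finite_generating_set Y H ->
     is_oe (fun r => (relative_growth X H r)%:R : R) (fun r => r%:R ^+ 2) ->
     bounded_by_recursive (distortion X Y H))
  /\
  (exists (G : groupType) (X Y H : set G),
     [/\ finite_generating_set X [set: G],
         is_subgroup H,
         finite_generating_set Y H,
         is_o (fun r => (relative_growth X H r)%:R : R) (fun r => r%:R ^+ 2) &
         ~ bounded_by_recursive (distortion X Y H)]).
Proof.
split=> [G X Y H genX Hsub genY /is_o_sqP|].
  exact: (subquadratic_virtually_cyclic genX Hsub genY).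
split=> [G X Y H genX Hsub genY /is_oe_sq[N recN NP]|].
  apply: (distortion_bounded_by_recursive genX Hsub genY recN NP).
  (* The modulus [N] serves as the threshold of the ordinary limit, so (1) applies. *)
  apply: (subquadratic_virtually_cyclic genX Hsub genY) => M M0.
  by exists (N M) => r; exact: NP.
have [G [X [Y [H [genX Hsub genY sub_quad nrec]]]]] :=
  subquadratic_growth_nonrecursive_distortion.
by exists G, X, Y, H; split=> //; apply/is_o_sqP.
Qed.
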